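(* Let $S=\mathcal{M}^0[G;I,\Lambda;P]$ be a finite (not necessarily regular) Rees matrix semigroup over a finite group $G$, whose structure matrix is in Graham normal form $$P=\begin{pmatrix} C_R & 0\\ 0 & C_N\end{pmatrix},$$ where $C_N$ is a $\Lambda'\times I'$ zero matrix (with $I'\subseteq I$, $\Lambda'\subseteq\Lambda$ the sets of indices of zero columns and zero rows of $P$) and $C_R:(\Lambda\setminus\Lambda')\times(I\setminus I')\to G\cup\{0\}$ is block diagonal with diagonal blocks $C_1,\dots,C_n$, where each $C_i:\Lambda_i\times I_i\to G\cup\{0\}$ is a connected regular matrix. If $P$ is a zero matrix then $\mathrm{rank}(S)=|G||I||\Lambda|$. Otherwise $$\mathrm{rank}(S)=\max\bigl(|I\setminus I'|,\ |\Lambda\setminus\Lambda'|,\ \sigma_{\min}+n-1\bigr)+|I'|+|\Lambda'|,$$ where, with $H_i$ denoting the subgroup of $G$ generated by the non-zero entries of $C_i$, $$\sigma_{\min}=\min\Bigl\{\mathrm{rank}\Bigl(G:\bigcup_{i=1}^n g_iH_ig_i^{-1}\Bigr)\ :\ g_1,\dots,g_n\in G\Bigr\}.$$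
   Context: Rees matrix semigroup: for a group $G$, non-empty disjoint index sets $I,\Lambda$ and a matrix $P=(p_{\lambda i})_{\lambda\in\Lambda,i\in I}$ with entries in $G\cup\{0\}$, the semigroup $\mathcal{M}^0[G;I,\Lambda;P]$ has underlying set $(I\times G\times\Lambda)\cup\{0\}$, with $0$ a zero element and $(i,g,\lambda)(j,h,\mu)=(i,gp_{\lambda j}h,\mu)$ if $p_{\lambda j}\neq 0$ and $=0$ otherwise. A matrix is regular if every row and every column contains a non-zero entry; regularity of $P$ is not assumed. Everything is finite. Graham--Houghton graph $\Gamma(S)$: the bipartite graph with vertex set $I\cup\Lambda$ and an edge joining $i\in I$ and $\lambda\in\Lambda$ exactly when $p_{\lambda i}\neq0$. The sets $I'$, $\Lambda'$ are the isolated vertices of $\Gamma(S)$ in $I$, $\Lambda$ respectively, and $I_1\cup\Lambda_1,\dots,I_n\cup\Lambda_n$ are the connected components of $\Gamma(S)$ on the remaining vertices $(I\setminus I')\cup(\Lambda\setminus\Lambda')$ (so ''connected'' for $C_i$ means that the bipartite graph on $I_i\cup\Lambda_i$ defined by the non-zero entries of $C_i$ is connected). Graham normal form: $P$ is arranged in the block form displayed in the claim and there is a spanning forest $\mathcal{F}$ of $\Gamma(S)$ (a spanning tree in each connected component) such that $p_{\lambda i}=1_G$ for every edge $\{i,\lambda\}$ of $\mathcal{F}$. (Every Rees matrix semigroup over a group is isomorphic to one of this form.) Rank: $\mathrm{rank}(S)=\min\{|X|:X\subseteq S,\ \langle X\rangle=S\}$, where, because $S$ has a zero, $\langle X\rangle$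 denotes by convention the set of all products of elements of $X$ together with $0$ (so the zero element never needs to be generated). Relative rank: for a subset $A$ of the group $G$, $\mathrm{rank}(G:A)=\min\{|X|:X\subseteq G,\ \langle A\cup X\rangle=G\}$. *)

(* Defs.v *)
From HB Require Import structures.
From mathcomp Require Import all_boot all_fingroup.
From mathcomp Require Import boolp.

Set Implicit Arguments.
Unset Strict Implicit.
Unset Printing Implicit Defensive.

Section SemigroupRank.
Variables (S : finType) (mul : S -> S -> S) (z : S).

(* All products of a nonempty word over X, together with the zero z. *)
Definition generated0 (X : {set S}) : {set S} :=
  [set x | `[< x = z \/
     exists (y : S) (s : seq S),
       [/\ y \in X, {subset s <= X} & x = foldl mul y s] >]].

Lemma generated0T : generated0 [set: S] = [set: S].
Proof.
apply/setP => x; rewrite !inE; apply/asboolP; right.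
by exists x, [::]; split=> // y.
Qed.

Definition semigroup_rank0 : nat :=
  #|[arg min_(X < [set: S] | generated0 X == [set: S]) #|X|]|.

Lemma semigroup_rank0P :
  (exists2 X : {set S}, generated0 X = [set: S] & #|X| = semigroup_rank0) /\
  (forall X : {set S}, generated0 X = [set: S] -> semigroup_rank0 <= #|X|).
Proof.
rewrite /semigroup_rank0; case: arg_minnP => [|X /eqP gX minX].
  by rewrite generated0T.
by split=> [|Y gY]; [exists X | apply/minX/eqP].
Qed.

End SemigroupRank.

Definition relative_rank (gT : finGroupType) (A : {set gT}) : nat :=
  #|[arg min_(X < [set: gT] | <<A :|: X>>%g == [set: gT]) #|X|]|.

Lemma relative_rankP (gT : finGroupType) (A : {set gT}) :
  (exists2 X : {set gT},
     <<A :|: X>>%g = [set: gT] & #|X| = relative_rank A) /\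
  (forall X : {set gT},
     <<A :|: X>>%g = [set: gT] -> relative_rank A <= #|X|).
Proof.
rewrite /relative_rank; case: arg_minnP => [|X /eqP gX minX].
  by rewrite setUT genGid.
by split=> [|Y gY]; [exists X | apply/minX/eqP].
Qed.

(* The graph on the disjoint union I + L with an edge {i, l} iff E i l. *)
Definition bipartite (I L : Type) (E : I -> L -> bool) : rel (I + L) :=
  fun u v => match u, v with
             | inl i, inr l => E i l
             | inr l, inl i => E i l
             | _, _ => false
             end.

Section Rees.
Variables (gT : finGroupType) (I L : finType).

(* The group is all of gT; the entry 0 of the matrix is None. *)
Variable P : L -> I -> option gT.

Definition rees : finType := option (I * gT * L).

Definition rees_zero : rees := None.

Definition rees_mul (x y : rees) : rees :=
  match x, y with
  | Some (i, g, l), Some (j, h, m) =>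
      if P l j is Some p then Some (i, (g * p * h)%g, m) else None
  | _, _ => None
  end.

Lemma rees_mulA : associative rees_mul.
Proof.
move=> [[[i g] l]|] [[[j h] m]|] [[[k f] o]|] //=.
- case Emk: (P m k) => [q|] //=; case Elj: (P l j) => [p|] //=.
  + by rewrite Emk !mulgA.
  + by rewrite Emk.
- by case: (P l j).
Qed.

Definition rees_rank : nat := semigroup_rank0 rees_mul rees_zero.

Definition graham_houghton : rel (I + L) :=
  bipartite (fun i l => P l i != None).

Definition zero_cols : {set I} := [set i | [forall l, P l i == None]].
Definition zero_rows : {set L} := [set l | [forall i, P l i == None]].

Definition regular_block (A : {set I}) (B : {set L}) : Prop :=
  (forall i, i \in A -> exists2 l, l \in B & P l i != None) /\
  (forall l, l \in B -> exists2 i, i \in A & P l i != None).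

Definition block_graph (A : {set I}) (B : {set L}) : rel (I + L) :=
  bipartite (fun i l => [&& i \in A, l \in B & P l i != None]).

Definition in_block (A : {set I}) (B : {set L}) (v : I + L) : bool :=
  match v with inl i => i \in A | inr l => l \in B end.

Definition connected_block (A : {set I}) (B : {set L}) : Prop :=
  [/\ A != set0, B != set0 &
      forall u v, in_block A B u -> in_block A B v ->
        connect (block_graph A B) u v].

(* Cycles of length 2 traverse a single edge back and forth. *)
Definition acyclic (T : eqType) (e : rel T) : Prop :=
  forall c : seq T, ucycle e c -> size c <= 2.

Record spanning_forest (F : {set I * L}) : Prop := SpanningForest {
  sf_sub : forall i l, (i, l) \in F -> P l i != None;
  sf_acyclic : acyclic (bipartite (fun i l => (i, l) \in F));
  sf_span : forall u v, connect graham_houghton u v ->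
    connect (bipartite (fun i l => (i, l) \in F)) u v
}.

Section Blocks.
Variables (n : nat) (Ib : 'I_n -> {set I}) (Lb : 'I_n -> {set L}).

(* I and L are unordered, so the block shape of P is a decomposition of the
   index sets; the blocks involving zero_cols or zero_rows vanish by
   definition. *)
Record graham_normal_form : Prop := GrahamNormalForm {
  gnf_cover_cols : \bigcup_k Ib k = ~: zero_cols;
  gnf_cover_rows : \bigcup_k Lb k = ~: zero_rows;
  gnf_disj_cols : forall j k, j != k -> [disjoint Ib j & Ib k];
  gnf_disj_rows : forall j k, j != k -> [disjoint Lb j & Lb k];
  gnf_off_diag : forall j k i l,
    j != k -> i \in Ib j -> l \in Lb k -> P l i = None;
  gnf_regular : forall k, regular_block (Ib k) (Lb k);
  gnf_connected : forall k, connected_block (Ib k) (Lb k);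
  gnf_forest : exists2 F : {set I * L}, spanning_forest F &
    forall i l, (i, l) \in F -> P l i = Some 1%g
}.

Definition block_entries (k : 'I_n) : {set gT} :=
  [set g | [exists i in Ib k, exists l in Lb k, P l i == Some g]].

Definition block_group (k : 'I_n) : {set gT} := <<block_entries k>>%g.

(* A :^ x is x^-1 A x, hence the inverse to obtain g H g^-1. *)
Definition sigma (g : {ffun 'I_n -> gT}) : nat :=
  relative_rank (\bigcup_k (block_group k :^ (g k)^-1)%g).

Definition sigma_min : nat :=
  sigma [arg min_(g < [ffun=> 1%g]) sigma g].

Lemma sigma_minP :
  (exists g, sigma g = sigma_min) /\ (forall g, sigma_min <= sigma g).
Proof.
rewrite /sigma_min; case: arg_minnP => // g _ ming.
by split=> [|h]; [exists g | apply: ming].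
Qed.

End Blocks.
End Rees.

(* Main.v *)
(* A generating set splits into the generators with non-zero row and column
   (the core), which alone generate the core of the semigroup, and generators
   that are needed one for each zero column and each zero row. So everything
   reduces to the core, where a generator (i, g, l) is regarded as an edge from
   i to l labelled g, an entry p_{l i} <> 0 as an edge from l to i, and products
   are labels of walks.

   Lower bound: contracting blocks to points, the core generators form a
   connected graph on n vertices. A potential trivialising the labels of a
   spanning tree shows that the generators off the tree, together with the
   corresponding conjugates of the H_k, generate G.

   Upper bound: as G is finite, walks in a strongly connected labelled digraph
   can be inverted, so only strong connectedness and undirected loops matter.
   Start from r pairs (i_t, l_t) exhausting the core indices. Exchanging the
   second components of two pairs lying in distinct strong components merges
   these components, so the pairs may be taken strongly connected. Finally,
   label n-1 pairs forming a spanning tree of the blocks according to an optimal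
   choice of conjugators, and spread an optimal relative generating set over
   the remaining pairs. *)

Require Import Defs.
From HB Require Import structures.
From mathcomp Require Import all_boot all_fingroup.
From mathcomp Require Import boolp.

Set Implicit Arguments.
Unset Strict Implicit.
Unset Printing Implicit Defensive.

(** * Strong components and spanning trees of finite graphs *)

Lemma connect_propagate (T : finType) (e : rel T) (Q : T -> Prop) x y :
  connect e x y -> Q x -> (forall u v, Q u -> e u v -> Q v) -> Q y.
Proof.
move=> /connectP [p ep ->] Qx Qe.
elim: p x ep Qx => //= z p IHp x /andP[exz pz] Qx.
by apply: IHp pz _; apply: Qe exz.
Qed.

Section CyclicPoints.
Variables (T : finType) (e : rel T).

Definition on_cycle x := exists2 y, e x y & connect e y x.

(** Among the points reachable from [x], take one that reaches as few points as possible. Any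
    successor of it reaches the same points, hence leads back to it. *)
Lemma reach_on_cycle x :
  (forall t, exists t', e t t') -> exists2 y, connect e x y & on_cycle y.
Proof.
move=> succ.
have [y cxy miny] := @arg_minnP T x (connect e x)
  (fun y => #|[set z | connect e y z]|) (connect0 e x).
have [z eyz] := succ y; exists y => //; exists z => //.
have cxz : connect e x z := connect_trans cxy (connect1 eyz).
have sub : [set t | connect e z t] \subset [set t | connect e y t].
  by apply/subsetP => t; rewrite !inE; apply: connect_trans (connect1 eyz).
have /setP/(_ y) : [set t | connect e z t] = [set t | connect e y t].
  by apply/eqP; rewrite eqEcard sub miny.
by rewrite !inE connect0.
Qed.

Lemma reached_from_on_cycle x :
  (forall t', exists t, e t t') -> exists2 y, connect e y x & on_cycle y.
Proof.
move=> pred.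
have [y cyx miny] := @arg_minnP T x (connect e ^~ x)
  (fun y => #|[set z | connect e z y]|) (connect0 e x).
have [z ezy] := pred y.
have czx : connect e z x := connect_trans (connect1 ezy) cyx.
exists z => //; exists y => //.
have sub : [set t | connect e t z] \subset [set t | connect e t y].
  apply/subsetP => t; rewrite !inE => ctz.
  exact: connect_trans ctz (connect1 ezy).
have /setP/(_ y) : [set t | connect e t z] = [set t | connect e t y].
  by apply/eqP; rewrite eqEcard sub miny.
by rewrite !inE connect0.
Qed.

End CyclicPoints.

(* Exchanging the out-neighbourhoods of two points lying on cycles in distinct
   strong components merges these components and destroys no connection. *)
Lemma swap_connect (T : finType) (D : rel T) (s : {perm T}) (x y : T) :
    let e := fun s : {perm T} => [rel u v | D (s u) v] in
    on_cycle (e s) x -> on_cycle (e s) y -> ~~ connect (e s) y x ->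
  (forall u v, connect (e s) u v -> connect (e (tperm x y * s)%g) u v)
  /\ connect (e (tperm x y * s)%g) y x.
Proof.
move=> e [x1 exx1 cx1x] [y1 eyy1 cy1y] ncyx; set s' := (tperm x y * s)%g.
have nyx : y != x by apply: contraNneq ncyx => ->; apply: connect0.
have s'x : s' x = s y by rewrite permM tpermL.
have s'y : s' y = s x by rewrite permM tpermR.
have s'E u : u != x -> u != y -> s' u = s u.
  by move=> ux uy; rewrite permM tpermD // eq_sym.
(* Follow the old path from [x1] up to its first visit to [x]. All its points reach [x], so it never
   meets [y], and the exchange leaves its edges unchanged. *)
have cx : connect (e s') x1 x.
  have H z : connect (e s) x1 z -> connect (e s) z x -> connect (e s') x1 x \/
     connect (e s') x1 z.
    move=> c1z; apply: (connect_propagate c1z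
      (Q := fun z => connect (e s) z x -> _)) => [_|u v Hu euv cvx].
      by right; apply: connect0.
    have cux : connect (e s) u x := connect_trans (connect1 euv) cvx.
    have [|cu] := Hu cux; first by left.
    have [uEx|ux] := eqVneq u x; first by left; rewrite -uEx.
    have uy : u != y by apply: contraNneq ncyx => <-.
    right; apply: connect_trans cu (connect1 _).
    by rewrite /e /= s'E.
  by case: (H x cx1x (connect0 _ _)).
(* Symmetrically, the points on the path from [y1] to [y] are reached from [y], so none of them is
   [x]. *)
have cy : connect (e s') y1 y.
  have H z : connect (e s) y1 z -> connect (e s') y1 y \/ connect (e s') y1 z.
    move=> c1z; suff [] : connect (e s) y1 z /\
      (connect (e s') y1 y \/ connect (e s') y1 z) by [].
    apply: (connect_propagate c1z (Q := fun z => connect (e s) y1 z /\ _)).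
      by split; [|right]; apply: connect0.
    move=> u v [cu Hu] euv; split; first exact: connect_trans cu (connect1 euv).
    case: Hu => [|cu']; first by left.
    have [uEy|uy] := eqVneq u y; first by left; rewrite -uEy.
    have cyu : connect (e s) y u := connect_trans (connect1 eyy1) cu.
    have ux : u != x by apply: contraNneq ncyx => <-.
    right; apply: connect_trans cu' (connect1 _).
    by rewrite /e /= s'E.
  by case: (H y cy1y).
have xy : connect (e s') x y.
  by apply: connect_trans cy; apply: connect1; rewrite /e /= s'x.
have yx : connect (e s') y x.
  by apply: connect_trans cx; apply: connect1; rewrite /e /= s'y.
(* Only the edges out of [x] and [y] have changed. An old edge out of one now leaves the other, and
   the two points reach each other. *)
split=> // u v cuv.
apply: (connect_propagate cuv (Q := fun z => connect (e s') u z)) => [|w z cw ewz].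
  exact: connect0.
apply: connect_trans cw _.
have [wx|wx] := eqVneq w x.
  rewrite wx in ewz *; apply: connect_trans xy (connect1 _).
  by rewrite /e /= s'y.
have [wy|wy] := eqVneq w y.
  rewrite wy in ewz *; apply: connect_trans yx (connect1 _).
  by rewrite /e /= s'x.
by apply: connect1; rewrite /e /= s'E.
Qed.

(** Take a permutation with the most connected pairs. If [u] did not reach [v], a cyclic point [y]
    reached from [u] and a cyclic point [x] reaching [v] would lie in different strong components,
    and exchanging their images would connect one more pair. *)
Lemma strongly_connecting_perm (T : finType) (D : rel T) :
    (forall t, exists t', D t t') -> (forall t', exists t, D t t') ->
  exists s : {perm T}, forall t t', connect [rel u v | D (s u) v] t t'.
Proof.
move=> succ pred; pose e (s : {perm T}) := [rel u v | D (s u) v].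
pose cp s := [set uv : T * T | connect (e s) uv.1 uv.2].
have [s _ maxs] := @arg_maxnP _ 1%g xpredT (fun s => #|cp s|) isT.
exists s => u v; apply: contraT => ncuv.
have [|y cuy cy] := @reach_on_cycle _ (e s) u; first by move=> t; apply: succ.
have [|x cxv cx] := @reached_from_on_cycle _ (e s) v.
  by move=> t'; have [t Dtt'] := pred t'; exists (s^-1 t)%g; rewrite /e /= permKV.
have ncyx : ~~ connect (e s) y x.
  apply: contra ncuv => cyx.
  exact: connect_trans cuy (connect_trans cyx cxv).
have [mono cyx] := @swap_connect T D s x y cx cy ncyx.
have : #|cp (tperm x y * s)%g| <= #|cp s| := maxs _ isT.
rewrite leqNgt => /negP[].
apply: proper_card; apply/properP; split.
  by apply/subsetP => -[a b]; rewrite !inE; apply: mono.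
by exists (y, x); rewrite inE.
Qed.

(* A cut criterion for connectedness is the form in which both the existence
   of the tree and its spanning property are used. *)
Lemma spanning_tree (B T : finType) (E : {set T}) (s d : T -> B) (x0 : B) :
    (forall A : {set B}, x0 \in A -> A != [set: B] ->
       exists2 t, t \in E & (s t \in A) != (d t \in A)) ->
  exists Z : {set T},
    [/\ Z \subset E, #|Z|.+1 = #|B|,
        forall Q : B -> Prop, (forall t, t \in Z -> (Q (s t) <-> Q (d t))) ->
          Q x0 -> forall y, Q y
      & forall (gT : finGroupType) (w : T -> gT), exists c : B -> gT,
          forall t, t \in Z -> c (d t) = (c (s t) * w t)%g].
Proof.
move=> cut.
(* A tree with [k] edges on [k.+1] vertices containing [x0] is grown by an edge crossing the cut,
   whose end outside [A] is the new vertex. *)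
suff grow k : k < #|B| -> exists (A : {set B}) (Z : {set T}),
    [/\ x0 \in A, #|A| = k.+1 & #|Z| = k] /\
    [/\ Z \subset E, forall t, t \in Z -> (s t \in A) && (d t \in A),
        forall Q : B -> Prop, (forall t, t \in Z -> (Q (s t) <-> Q (d t))) ->
          Q x0 -> forall y, y \in A -> Q y
      & forall (gT : finGroupType) (w : T -> gT), exists c : B -> gT,
          forall t, t \in Z -> c (d t) = (c (s t) * w t)%g].
  have B_gt0 : 0 < #|B| by apply/card_gt0P; exists x0.
  have [|A [Z [[x0A cA cZ] [ZE ZA span pot]]]] := grow #|B|.-1.
    by rewrite prednK.
  rewrite prednK // in cA.
  have AT : A = [set: B] by apply/eqP; rewrite eqEcard subsetT cardsT cA leqnn.
  exists Z; split=> //; first by rewrite cZ prednK.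
  by move=> Q HQ Q0 y; apply: span HQ Q0 _ _; rewrite AT inE.
elim: k => [_|k IHk ltk].
  exists [set x0], set0; rewrite inE eqxx cards1 cards0; do 2!split=> //.
  - exact: sub0set.
  - by move=> t; rewrite in_set0.
  - by move=> Q _ Q0 y; rewrite inE => /eqP->.
  - by move=> gT w; exists (fun=> 1%g) => t; rewrite in_set0.
have [A [Z [[x0A cA cZ] [ZE ZA span pot]]]] := IHk (ltnW ltk).
have [|t tE cross] := cut A x0A.
  by apply: contraTneq ltk => AT; rewrite -cA AT cardsT ltnn.
have tZ : t \notin Z.
  by apply: contra cross => /ZA /andP[-> ->].
pose v := if s t \in A then d t else s t.
have vA : v \notin A.
  by rewrite /v; move: cross; case: (boolP (s t \in A)) => // _; case: (d t \in A).
exists (v |: A), (t |: Z); rewrite !cardsU1 vA tZ cA cZ !inE x0A orbT.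
do 2!split=> //.
- by rewrite subUset sub1set tE.
- move=> t'; rewrite !inE => /predU1P[->|/ZA/andP[-> ->]]; last by rewrite !orbT.
  rewrite /v; move: cross.
  by case: (s t \in A); case: (d t \in A); rewrite ?eqxx ?orbT.
- move=> Q HQ Q0 y; rewrite !inE => yvA.
  have QA z : z \in A -> Q z.
    by apply: span Q0 z => t' t'Z; apply: HQ; rewrite !inE t'Z orbT.
  case/predU1P: yvA => [->|]; last exact: QA.
  have [Qsd Qds] : Q (s t) <-> Q (d t) by apply: HQ; rewrite !inE eqxx.
  rewrite /v; move: cross; case: (boolP (s t \in A)) => [sA _|_].
    exact/Qsd/QA.
  by case: (boolP (d t \in A)) => // dA _; apply/Qds/QA.
- move=> gT w; have [c Hc] := pot gT w.
  (* The potential at the new vertex is forced by the new edge, which may point away from the tree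
     or towards it. *)
  exists (fun y => if y == v then
     (if s t \in A then c (s t) * w t else c (d t) * (w t)^-1)%g else c y).
  move=> t'; rewrite !inE => /predU1P[->|t'Z].
    rewrite /v; move: cross; case: (boolP (s t \in A)) => [sA|sA].
      rewrite eqxx; case: (boolP (d t \in A)) => // dA _.
      by case: eqP => // sd; rewrite -sd sA in dA.
    rewrite eqxx; case: (boolP (d t \in A)) => // dA _.
    case: eqP => [sd|_]; last by rewrite mulgKV.
    by rewrite -sd dA in sA.
  have /andP[sA dA] := ZA _ t'Z; rewrite (Hc _ t'Z).
  by do 2![case: eqP => [E'|_]; first by rewrite -E' ?sA ?dA in vA].
Qed.

(** * Walks labelled by group elements *)

Section Walks.
Variables (gT : finGroupType) (V : Type) (e : V -> V -> gT -> Prop).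

Inductive walk (u : V) : V -> gT -> Prop :=
| walk_nil : walk u u 1%g
| walk_rcons v w g h of walk u v g & e v w h : walk u w (g * h)%g.

Lemma walk_edge u v g : e u v g -> walk u v g.
Proof. by move=> euv; rewrite -[g]mul1g; apply: walk_rcons euv; apply: walk_nil. Qed.

Lemma walk_cat u v w g h : walk u v g -> walk v w h -> walk u w (g * h)%g.
Proof.
move=> Wuv; elim=> [|w' x h' k _ IH ewx]; first by rewrite mulg1.
by rewrite mulgA; apply: walk_rcons IH ewx.
Qed.

(* The label of a closed walk has finite order, so iterating the walk
   inverts it. *)
Lemma walkV u v g h : walk u v g -> walk v u h -> walk v u g^-1%g.
Proof.
move=> Wuv Wvu; have Wk k : walk u u ((g * h) ^+ k)%g.
  elim: k => [|k IHk]; first exact: walk_nil.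
  by rewrite expgSr; apply: walk_cat IHk (walk_cat Wuv Wvu).
have -> : (g^-1 = h * (g * h)^-1)%g by rewrite invMg mulKVg.
by rewrite invg_expg; apply: walk_cat Wvu (Wk _).
Qed.

(** Labels of closed walks at [u] contain 1 and are closed under products, which in a finite group
    makes them a subgroup. *)
Lemma walk_gen u (A : {set gT}) :
  (forall x, x \in A -> walk u u x) -> forall x, x \in <<A>>%g -> walk u u x.
Proof.
move=> WA x Ax; have gS : group_set [set y | `[< walk u u y >]].
  apply/group_setP; split; first by rewrite inE; apply/asboolP; apply: walk_nil.
  move=> y z; rewrite !inE => /asboolP Wy /asboolP Wz.
  by apply/asboolP; apply: walk_cat Wy Wz.
suff : <<A>>%g \subset Group gS by move/subsetP/(_ x Ax); rewrite inE => /asboolP.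
by rewrite gen_subG; apply/subsetP => y /WA Wy; rewrite inE; apply/asboolP.
Qed.

End Walks.

(** Elements are matched by their positions in the two enumerations, and positions beyond the end of
    [A] receive the default [x0]. *)
Lemma cover_function (U T : finType) (B : {set U}) (A : {set T}) (x0 : T) :
    #|A| <= #|B| ->
  exists2 f : U -> T, forall u, f u = x0 \/ f u \in A
    & forall x, x \in A -> exists2 u, u \in B & f u = x.
Proof.
move=> leAB; exists (fun u => nth x0 (enum A) (index u (enum B))) => [u|x xA].
  case: (ltnP (index u (enum B)) (size (enum A))) => [lt|ge].
    by right; rewrite -mem_enum mem_nth.
  by left; rewrite nth_default.
have ltx : index x (enum A) < size (enum B).
  by rewrite -cardE (leq_trans _ leAB) // cardE index_mem mem_enum.
case: (set_0Vmem B) ltx => [->|[u0 _] ltx]; first by rewrite enum_set0.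
exists (nth u0 (enum B) (index x (enum A))).
  by rewrite -mem_enum mem_nth.
by rewrite index_uniq ?enum_uniq // nth_index // mem_enum.
Qed.

(** * Products of generators in semigroups and Rees matrix semigroups *)

Section Generated.
Variables (S : finType) (mul : S -> S -> S) (z : S).
Local Notation gen := (generated0 mul z).

Lemma mem_generated0 (X : {set S}) x : x \in X -> x \in gen X.
Proof.
by move=> xX; rewrite inE; apply/asboolP; right; exists x, [::]; split=> // y.
Qed.

Lemma generated0_ind (X : {set S}) (Q : S -> Prop) :
    Q z -> (forall x, x \in X -> Q x) ->
    (forall x y, Q x -> y \in X -> Q (mul x y)) ->
  forall x, x \in gen X -> Q x.
Proof.
move=> Qz QX Qmul x; rewrite inE => /asboolP[->//|[y [s [yX sX ->]]]].
elim/last_ind: s sX => [_|s w IHs sX] /=; first exact: QX.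
rewrite foldl_rcons; apply: Qmul; last by apply: sX; rewrite mem_rcons inE eqxx.
by apply: IHs => v vs; apply: sX; rewrite mem_rcons inE vs orbT.
Qed.

Hypotheses (mulA : associative mul) (mulz : forall x, mul x z = z).
Hypothesis mul0z : forall x, mul z x = z.

Lemma generated0_mul (X : {set S}) x y :
  x \in gen X -> y \in gen X -> mul x y \in gen X.
Proof.
move=> Gx Gy; move: x Gx.
apply: (generated0_ind (Q := fun y => forall x, x \in gen X -> mul x y \in gen X)
  _ _ _ Gy) => {y Gy}.
- by move=> x _; rewrite mulz inE; apply/asboolP; left.
- move=> y yX x; rewrite !inE => /asboolP[->|[x1 [s [x1X sX ->]]]]; apply/asboolP.
    by left; rewrite mul0z.
  right; exists x1, (rcons s y); split=> //; last by rewrite foldl_rcons.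
  by move=> v; rewrite mem_rcons inE => /predU1P[->|/sX].
- move=> y w IHy wX x Gx; rewrite mulA.
  have := IHy _ Gx; rewrite !inE => /asboolP[->|[x1 [s [x1X sX ->]]]]; apply/asboolP.
    by left; rewrite mul0z.
  right; exists x1, (rcons s w); split=> //; last by rewrite foldl_rcons.
  by move=> v; rewrite mem_rcons inE => /predU1P[->|/sX].
Qed.

End Generated.

Section ReesGeneration.
Variables (gT : finGroupType) (I L : finType) (P : L -> I -> option gT).
Local Notation Ic := (~: zero_cols P).
Local Notation Lc := (~: zero_rows P).
Local Notation gen := (generated0 (rees_mul P) (rees_zero gT I L)).

Lemma nonzero_colP i : reflect (exists l p, P l i = Some p) (i \in Ic).
Proof.
rewrite !inE negb_forall; apply: (iffP existsP) => [[l]|[l [p Pli]]].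
  by case Pli: (P l i) => [p|] // _; exists l, p.
by exists l; rewrite Pli.
Qed.

Lemma nonzero_rowP l : reflect (exists i p, P l i = Some p) (l \in Lc).
Proof.
rewrite !inE negb_forall; apply: (iffP existsP) => [[i]|[i [p Pli]]].
  by case Pli: (P l i) => [p|] // _; exists i, p.
by exists i; rewrite Pli.
Qed.

Lemma entry_col l i p : P l i = Some p -> i \in Ic.
Proof. by move=> Pli; apply/nonzero_colP; exists l, p. Qed.

Lemma entry_row l i p : P l i = Some p -> l \in Lc.
Proof. by move=> Pli; apply/nonzero_rowP; exists i, p. Qed.

Lemma gen_mul (X : {set rees gT I L}) x y : x \in gen X -> y \in gen X -> rees_mul P x y \in gen X.
Proof.
apply: generated0_mul; [exact: rees_mulA | by move=> [[[]]|] | by []].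
Qed.

Lemma gen_prod (X : {set rees gT I L}) i g l p j h m :
    Some (i, g, l) \in gen X -> P l j = Some p -> Some (j, h, m) \in gen X ->
  Some (i, (g * p * h)%g, m) \in gen X.
Proof. by move=> Gx Plj Gy; have := gen_mul Gx Gy; rewrite /= Plj. Qed.

(** The witness is the first factor of a product. Its row is [l] if it is the only factor, and
    otherwise meets the next factor at a non-zero entry. *)
Lemma generated_col (X : {set rees gT I L}) i g l :
    Some (i, g, l) \in gen X -> l \in Lc ->
  exists h l', Some (i, h, l') \in X /\ l' \in Lc.
Proof.
pose Q (x : rees gT I L) := if x is Some (i, g, l) then
  l \in Lc -> exists h l', Some (i, h, l') \in X /\ l' \in Lc else True.
move=> Gx; have: Q (Some (i, g, l)); last by [].
apply: (generated0_ind (Q := Q) _ _ _ Gx) => //= [[[[j h] m]|]//|].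
  by move=> xX mc; exists h, m.
move=> [[[j h] m]|] [[[j' h'] m']|] //= IH _.
by case Pm: (P m j') => [p|] //= _; apply: IH; apply: entry_row Pm.
Qed.

Lemma generated_row (X : {set rees gT I L}) i g l :
    Some (i, g, l) \in gen X -> i \in Ic ->
  exists j h, Some (j, h, l) \in X /\ j \in Ic.
Proof.
pose Q (x : rees gT I L) := if x is Some (i, g, l) then
  i \in Ic -> exists j h, Some (j, h, l) \in X /\ j \in Ic else True.
move=> Gx; have: Q (Some (i, g, l)); last by [].
apply: (generated0_ind (Q := Q) _ _ _ Gx) => //= [[[[j h] m]|]//|].
  by move=> xX mc; exists j, h.
move=> [[[j h] m]|] [[[j' h'] m']|] //= IH yX.
case Pm: (P m j') => [p|] //= _; exists j', h'; split=> //.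
exact: entry_col Pm.
Qed.

Definition core_elt (x : rees gT I L) :=
  if x is Some (i, _, l) then (i \in Ic) && (l \in Lc) else false.

(** In a non-zero product all inner indices meet at non-zero entries. If the two outer indices are
    also non-zero ones, then every factor lies in the core. *)
Lemma generated_core (X : {set rees gT I L}) (Q : I -> gT -> L -> Prop) :
    (forall i g l, Some (i, g, l) \in [set x in X | core_elt x] -> Q i g l) ->
    (forall i g l p j h m, Q i g l -> P l j = Some p -> Q j h m ->
       Q i (g * p * h)%g m) ->
  forall i g l, i \in Ic -> l \in Lc -> Some (i, g, l) \in gen X -> Q i g l.
Proof.
move=> QX Qmul i g l ic lc Gx.
pose R (x : rees gT I L) := if x is Some (i, g, l) then
  i \in Ic -> l \in Lc -> Q i g l else True.
have: R (Some (i, g, l)); last by apply.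
apply: (generated0_ind (Q := R) _ _ _ Gx) => //= [[[[j h] m]|]//|].
  by move=> xX jc mc; apply: QX; rewrite inE xX /= jc mc.
move=> [[[j h] m]|] [[[j' h'] m']|] //= IH yX.
case Pm: (P m j') => [p|] //= jc m'c; apply: (Qmul _ _ _ _ _ _ _ _ Pm).
  by apply: IH => //; apply: entry_row Pm.
by apply: QX; rewrite inE yX /= m'c (entry_col Pm).
Qed.

(** All products vanish, so each non-zero element has to be a generator, while zero comes for
    free. *)
Lemma rank_zero_matrix :
  (forall l i, P l i = None) -> rees_rank P = #|gT| * #|I| * #|L|.
Proof.
move=> P0; have [[X gX cX] minX] := semigroup_rank0P (rees_mul P) (rees_zero gT I L).
have card_nz : #|[set~ (None : rees gT I L)]| = #|gT| * #|I| * #|L|.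
  have := cardsC1 (None : rees gT I L).
  by rewrite card_option !card_prod [(#|I| * _)%N]mulnC.
rewrite -card_nz /rees_rank; apply/eqP; rewrite eqn_leq -{2}cX.
apply/andP; split.
  apply: minX; apply/setP => x; rewrite in_setT.
  case: x => [x|]; last by rewrite inE; apply/asboolP; left.
  by rewrite mem_generated0 // !inE.
apply: subset_leq_card; apply/subsetP => x; rewrite !inE.
have : x \in gen X by rewrite gX inE.
rewrite inE => /asboolP[->|[y [s [yX _ ->]]]]; first by rewrite eqxx.
have mul0 u v : rees_mul P u v = None.
  by case: u v => [[[i g] l]|] [[[j h] m]|] //=; rewrite P0.
elim/last_ind: s => [|s w _] //=.
by rewrite foldl_rcons mul0 eqxx.
Qed.

(* A product decomposes only into factors whose adjacent indices meet at a
   non-zero entry: generators in a zero row or a zero column contribute nothing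
   to the rest. *)
Lemma card_generating_ge (X : {set rees gT I L}) i0 l0 :
    gen X = [set: rees gT I L] -> i0 \in Ic -> l0 \in Lc ->
  #|[set x in X | core_elt x]| + #|zero_cols P| + #|zero_rows P| <= #|X| /\
  maxn #|Ic| #|Lc| <= #|[set x in X | core_elt x]|.
Proof.
move=> gX i0c l0c; have G x : x \in gen X by rewrite gX inE.
(* The values [i0] and [l0] at zero are non-zero indices, which keeps the zero element out of [X1]
   and [X2] below. *)
pose col (x : rees gT I L) := if x is Some (i, _, _) then i else i0.
pose row (x : rees gT I L) := if x is Some (_, _, l) then l else l0.
set Xc := [set x in X | core_elt x].
split; last first.
  rewrite geq_max; apply/andP; split.
    apply: leq_trans (leq_imset_card col Xc); apply: subset_leq_card.
    apply/subsetP => i ic; apply/imsetP.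
    have [h [l [xX lc]]] := generated_col (G (Some (i, 1%g, l0))) l0c.
    by exists (Some (i, h, l)); rewrite // inE xX /= ic lc.
  apply: leq_trans (leq_imset_card row Xc); apply: subset_leq_card.
  apply/subsetP => l lc; apply/imsetP.
  have [j [h [xX jc]]] := generated_row (G (Some (i0, 1%g, l))) i0c.
  by exists (Some (j, h, l)); rewrite // inE xX /= jc lc.
pose X1 := [set x in X | (col x \notin Ic) && (row x \in Lc)].
pose X2 := [set x in X | (col x \in Ic) && (row x \notin Lc)].
have le1 : #|zero_cols P| <= #|X1|.
  apply: leq_trans (leq_imset_card col X1); apply: subset_leq_card.
  apply/subsetP => i ic; apply/imsetP.
  have [h [l [xX lc]]] := generated_col (G (Some (i, 1%g, l0))) l0c.
  by exists (Some (i, h, l)); rewrite // inE xX /= lc in_setC ic.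
have le2 : #|zero_rows P| <= #|X2|.
  apply: leq_trans (leq_imset_card row X2); apply: subset_leq_card.
  apply/subsetP => l lc; apply/imsetP.
  have [j [h [xX jc]]] := generated_row (G (Some (i0, 1%g, l))) i0c.
  by exists (Some (j, h, l)); rewrite // inE xX /= jc in_setC lc.
apply: leq_trans (leq_add (leq_add (leqnn _) le1) le2) _.
have d1 : [disjoint Xc & X1].
  apply/pred0P => x; apply/negP => /andP[] /=.
  rewrite [x \in Xc]inE [x \in X1]inE => /andP[_ xc] /andP[_ /andP[nc _]].
  by case: x xc nc => [[[i g] l]|] //= /andP[->].
have d2 : [disjoint Xc :|: X1 & X2].
  apply/pred0P => x; apply/negP => /andP[] /=.
  rewrite in_setU [x \in Xc]inE [x \in X1]inE [x \in X2]inE.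
  move=> + /andP[_ /andP[c nr]].
  case/orP=> /andP[_ xc]; last by rewrite c in xc.
  by case: x xc c nr => [[[i g] l]|] //= /andP[_ ->].
rewrite -(leq_card_setU Xc X1).2 in d1.
rewrite -(eqP d1) -(leq_card_setU _ _).2 in d2 *.
rewrite -(eqP d2); apply: subset_leq_card.
by rewrite !subUset -andbA; apply/and3P; split; apply/subsetP => x; rewrite inE => /andP[].
Qed.

End ReesGeneration.

(** * Blocks and the lower bound by relative rank *)

Section Blocks.
Variables (gT : finGroupType) (I L : finType) (P : L -> I -> option gT).
Variables (n : nat) (Ib : 'I_n -> {set I}) (Lb : 'I_n -> {set L}).
Hypothesis gnfP : graham_normal_form P Ib Lb.
Variable k0 : 'I_n.
Local Notation Ic := (~: zero_cols P).
Local Notation Lc := (~: zero_rows P).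
Local Notation gen := (generated0 (rees_mul P) (rees_zero gT I L)).

(** The default [k0] is only a filler for indices lying in no block, that is, for zero columns and
    zero rows. *)
Definition col_block i := odflt k0 [pick k | i \in Ib k].
Definition row_block l := odflt k0 [pick k | l \in Lb k].

Lemma mem_col_block i : i \in Ic -> i \in Ib (col_block i).
Proof.
rewrite -(gnf_cover_cols gnfP) => /bigcupP[k _ ik]; rewrite /col_block.
by case: pickP => //= /(_ k); rewrite ik.
Qed.

Lemma mem_row_block l : l \in Lc -> l \in Lb (row_block l).
Proof.
rewrite -(gnf_cover_rows gnfP) => /bigcupP[k _ lk]; rewrite /row_block.
by case: pickP => //= /(_ k); rewrite lk.
Qed.

Lemma block_col_nonzero k i : i \in Ib k -> i \in Ic.
Proof. by move=> ik; rewrite -(gnf_cover_cols gnfP); apply/bigcupP; exists k. Qed.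

Lemma block_row_nonzero k l : l \in Lb k -> l \in Lc.
Proof. by move=> lk; rewrite -(gnf_cover_rows gnfP); apply/bigcupP; exists k. Qed.

Lemma col_block_eq k i : i \in Ib k -> col_block i = k.
Proof.
move=> ik; apply/eqP; apply: contraT => /(gnf_disj_cols gnfP)/pred0P/(_ i) /=.
by rewrite ik mem_col_block // (block_col_nonzero ik).
Qed.

Lemma row_block_eq k l : l \in Lb k -> row_block l = k.
Proof.
move=> lk; apply/eqP; apply: contraT => /(gnf_disj_rows gnfP)/pred0P/(_ l) /=.
by rewrite lk mem_row_block // (block_row_nonzero lk).
Qed.

Lemma entry_block l i p : P l i = Some p -> col_block i = row_block l.
Proof.
move=> Pli; apply/eqP; apply: contraT => /(gnf_off_diag gnfP) H.
by have := H i l (mem_col_block (entry_col Pli)) (mem_row_block (entry_row Pli));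
  rewrite Pli.
Qed.

Lemma block_col_ex k : exists2 i, i \in Ic & col_block i = k.
Proof.
have [/set0Pn[i ik] _ _] := gnf_connected gnfP k.
by exists i; [apply: block_col_nonzero ik | apply: col_block_eq].
Qed.

Lemma block_row_ex k : exists2 l, l \in Lc & row_block l = k.
Proof.
have [_ /set0Pn[l lk] _] := gnf_connected gnfP k.
by exists l; [apply: block_row_nonzero lk | apply: row_block_eq].
Qed.

Lemma mem_block_group l i p :
  P l i = Some p -> p \in block_group P Ib Lb (col_block i).
Proof.
move=> Pli; apply: mem_gen; rewrite inE; apply/exists_inP; exists i.
  by rewrite mem_col_block // (entry_col Pli).
apply/exists_inP; exists l; last by rewrite Pli.
by rewrite (entry_block Pli) mem_row_block // (entry_row Pli).
Qed.

(* The core generators are the edges of a connected graph on the blocks. A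
   potential [c] trivialising the labels along a spanning tree conjugates all
   labels of products into the subgroup generated by the [c_k H_k c_k^-1] and
   the generators off the tree. *)
Lemma sigma_min_le (X : {set rees gT I L}) :
    gen X = [set: rees gT I L] ->
  sigma_min P Ib Lb + n <= #|[set x in X | core_elt P x]|.+1.
Proof.
move=> gX; have G x : x \in gen X by rewrite gX inE.
set Xc := [set x in X | core_elt P x].
pose s (x : rees gT I L) := if x is Some (i, _, _) then col_block i else k0.
pose d (x : rees gT I L) := if x is Some (_, _, l) then row_block l else k0.
pose w (x : rees gT I L) := if x is Some (_, g, _) then g else 1%g.
have [|Z [ZX cZ _ pot]] := @spanning_tree _ _ Xc s d k0.
  (* If no core generator crossed the cut, no core element would, since entries stay within a block.
     But some core element leads from block [k0] to a block outside [A]. *)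
  move=> A k0A AT; apply/exists_inP; apply: contraT.
  rewrite negb_exists_in => /forall_inP nocross.
  have /subsetPn[k _ kA] : ~~ ([set: 'I_n] \subset A) by rewrite subTset.
  have [i ic ik] := block_col_ex k0; have [l lc lk] := block_row_ex k.
  suff: (col_block i \in A) = (row_block l \in A).
    by rewrite ik lk k0A (negPf kA).
  apply: (@generated_core _ _ _ P X
    (fun i _ l => (col_block i \in A) = (row_block l \in A)) _ _ i 1%g l) => //.
    by move=> i' g' l' /nocross; rewrite negbK => /eqP.
  by move=> i' g' l' p j h m E1 /entry_block E2; rewrite E1 -E2.
have [c Hc] := pot gT w; rewrite card_ord in cZ.
pose Y := [set (c (s x) * w x * (c (d x))^-1)%g | x in Xc :\: Z].
pose H := (\bigcup_k (block_group P Ib Lb k :^ ([ffun k => c k] k)^-1))%g.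
have genK : <<H :|: Y>>%g = [set: gT].
  apply/eqP; rewrite eqEsubset subsetT; apply/subsetP => x _.
  have [i ic ik] := block_col_ex k0; have [l lc lk] := block_row_ex k0.
  have KX : forall i g l, i \in Ic -> l \in Lc -> Some (i, g, l) \in gen X ->
     (c (col_block i) * g * (c (row_block l))^-1)%g \in <<H :|: Y>>%g.
    apply: generated_core => [i' g' l' xX|i' g' l' p j h m K1 Plj K2].
      case: (boolP (Some (i', g', l') \in Z)) => [/Hc /= -> | xZ].
        by rewrite mulgV group1.
      rewrite mem_gen // inE; apply/orP; right; apply/imsetP.
      by exists (Some (i', g', l')); rewrite // inE xZ.
    have Kp : (c (col_block j) * p * (c (col_block j))^-1)%g \in <<H :|: Y>>%g.
      rewrite mem_gen // inE; apply/orP; left; apply/bigcupP.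
      exists (col_block j) => //; rewrite ffunE.
      have -> : (c (col_block j) * p * (c (col_block j))^-1 =
        p ^ (c (col_block j))^-1)%g by rewrite conjgE invgK mulgA.
      by rewrite memJ_conjg (mem_block_group Plj).
    rewrite -(entry_block Plj) in K1.
    by have := groupM (groupM K1 Kp) K2; rewrite !mulgA !mulgKV.
  (* Both indices lie in block [k0], so conjugating this label by the potential returns [x]
     itself. *)
  have := KX i ((c k0)^-1 * x * c k0)%g l ic lc (G _).
  by rewrite ik lk !mulgA mulgV mul1g mulgK.
have le_sig : sigma_min P Ib Lb <= #|Y|.
  apply: leq_trans ((sigma_minP P Ib Lb).2 [ffun k => c k]) _.
  exact: (relative_rankP _).2 _ genK.
(* The tree uses [n - 1] of the core generators, and [Y] has at most one element for each of the
   others. *)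
rewrite -[X in _ + X]cZ addnS ltnS -[X in _ <= X](cardsID Z).
rewrite (setIidPr ZX) addnC leq_add2l.
exact: leq_trans le_sig (leq_imset_card _ _).
Qed.

(** * Products of generators as walks *)

Section WalksGenerate.
Variable X : {set rees gT I L}.

Definition rees_step (u v : I + L) (g : gT) : Prop :=
  match u, v with
  | inl i, inr l => Some (i, g, l) \in X
  | inr l, inl i => P l i = Some g
  | _, _ => False
  end.
Local Notation W := (walk rees_step).

Definition vertex_core (v : I + L) :=
  match v with inl i => i \in Ic | inr l => l \in Lc end.
Definition vertex_block (v : I + L) :=
  match v with inl i => col_block i | inr l => row_block l end.

(** A walk alternates between generators and entries. At a column vertex it is either still empty or
    consists of a generated element followed by an entry, which is what [Q] records. *)
Lemma walk_generated i l g : W (inl i) (inr l) g -> Some (i, g, l) \in gen X.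
Proof.
pose Q (v : I + L) g := match v with
  | inr l => Some (i, g, l) \in gen X
  | inl j => i = j /\ g = 1%g \/
      exists l h p, [/\ Some (i, h, l) \in gen X, P l j = Some p & g = (h * p)%g]
  end.
move=> Wil; have: Q (inr l) g; last by [].
elim: {l} Wil => [|v w g' h _]; first by left.
case: v w => [j|m] [j'|m'] //= IH step; last by right; exists m, g', h.
have Gx : Some (j, h, m') \in gen X by apply: mem_generated0.
case: IH => [[<- ->]|[l [h' [p [Gy Plj ->]]]]] in Gx *; first by rewrite mul1g.
exact: gen_prod Gy Plj Gx.
Qed.

Hypothesis strong : forall i l, i \in Ic -> l \in Lc ->
  exists g, W (inl i) (inr l) g.

(** Each non-zero row has an entry edge leaving it and each non-zero column one arriving at it, so
    walks from columns to rows suffice. *)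
Lemma walk_ex u v : vertex_core u -> vertex_core v -> exists g, W u v g.
Proof.
move=> uc vc.
have [i [g [ic Wui]]] : exists i g, i \in Ic /\ W u (inl i) g.
  case: u uc => [i|l] /= c; first by exists i, 1%g; split=> //; apply: walk_nil.
  have [i [p Pli]] := nonzero_rowP _ _ c; exists i, p.
  by split; [apply: entry_col Pli | apply: walk_edge].
have [l [h [lc Wlv]]] : exists l h, l \in Lc /\ W (inr l) v h.
  case: v vc => [i'|l] /= c; last by exists l, 1%g; split=> //; apply: walk_nil.
  have [l [p Pli]] := nonzero_colP _ _ c; exists l, p.
  by split; [apply: entry_row Pli | apply: walk_edge].
have [k Wil] := strong ic lc; exists (g * k * h)%g.
exact: walk_cat (walk_cat Wui Wil) Wlv.
Qed.

Lemma core_walkV u v g :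
  vertex_core u -> vertex_core v -> W u v g -> W v u g^-1%g.
Proof. by move=> uc vc Wuv; have [h] := walk_ex vc uc; apply: walkV. Qed.

(** The normal form is used here: the forest edges carry label 1 and can be walked backwards too, so
    a forest path joins [u] to [v] with label 1. *)
Lemma block_walk1 u v :
  vertex_core u -> vertex_core v -> vertex_block u = vertex_block v -> W u v 1%g.
Proof.
move=> uc vc uv; have [F sfF F1] := gnf_forest gnfP.
have [_ _ /(_ u v) con] := gnf_connected gnfP (vertex_block u).
have inb x : vertex_core x -> in_block (Ib (vertex_block x)) (Lb (vertex_block x)) x.
  by case: x => [i|l] /=; [apply: mem_col_block | apply: mem_row_block].
have {}con : connect (graham_houghton P) u v.
  have := con (inb u uc); rewrite {1 2}uv => /(_ (inb v vc)).
  apply: connect_sub => -[i|l] [j|m] //= /and3P[_ _ Pne]; exact: connect1.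
have step l i : (i, l) \in F -> W (inr l) (inl i) 1%g /\ W (inl i) (inr l) 1%g.
  move=> /F1 Pli; have Wli : W (inr l) (inl i) 1%g by apply: walk_edge.
  split=> //; rewrite -invg1; apply: core_walkV Wli.
    exact: entry_row Pli.
  exact: entry_col Pli.

apply: (connect_propagate (sf_span sfF con) (Q := fun v => W u v 1%g)).
  exact: walk_nil.
move=> x y Wux; rewrite -[X in W u y X]mulg1 => Fxy; apply: walk_cat Wux _.
by case: x y Fxy => [i|l] [j|m] //= /step[].
Qed.

Lemma block_group_walk u x :
  vertex_core u -> x \in block_group P Ib Lb (vertex_block u) -> W u u x.
Proof.
move=> uc; apply: walk_gen => {}x; rewrite inE.
case/exists_inP=> i ik /exists_inP[l lk /eqP Pli].
have Wli : W (inr l) (inl i) x by apply: walk_edge.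
have Wul : W u (inr l) 1%g.
  by apply: block_walk1; rewrite //= ?(entry_row Pli) // (row_block_eq lk).
have Wiu : W (inl i) u 1%g.
  by apply: block_walk1; rewrite //= ?(entry_col Pli) // (col_block_eq ik).
by have := walk_cat (walk_cat Wul Wli) Wiu; rewrite mul1g mulg1.
Qed.

(** Moving to another vertex and back along walks labelled by [c] turns closed walks there into
    closed walks at [u]. The labels at [u] thus include a conjugate of a generating set of the
    group, and any single walk to [l] can be corrected to have label [g]. *)
Lemma core_generated (c : {ffun 'I_n -> gT}) (Y : {set gT}) :
    let cv v := c (vertex_block v) in
    (forall u v, vertex_core u -> vertex_core v -> W u v ((cv u)^-1 * cv v)%g) ->
    (forall y, y \in Y -> exists u v, [/\ vertex_core u, vertex_core v &
       W u v ((cv u)^-1 * y * cv v)%g]) ->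
    <<\bigcup_k (block_group P Ib Lb k :^ (c k)^-1) :|: Y>>%g = [set: gT] ->
  forall i g l, i \in Ic -> l \in Lc -> Some (i, g, l) \in gen X.
Proof.
move=> cv Wc WY genT i g l ic lc; apply: walk_generated.
pose u : I + L := inl i; have uc : vertex_core u by [].
have Wuu x : W u u x.
  have: x \in <<(\bigcup_k (block_group P Ib Lb k :^ (c k)^-1) :|: Y) :^ cv u>>%g.
    by rewrite genJ genT mem_conjg inE.
  apply: walk_gen => {}x /imsetP[y + ->]; rewrite inE.
  case/orP=> [/bigcupP[k _]|/WY[v [w [vc wc Wvw]]]].
    case/imsetP=> h hk ->; have [j jc jk] := block_col_ex k.
    have vc : vertex_core (inl j) by [].
    have Wvv : W (inl j) (inl j) h by apply: block_group_walk; rewrite //= jk.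
    have := walk_cat (walk_cat (Wc _ _ uc vc) Wvv) (Wc _ _ vc uc).
    have -> // : (((cv u)^-1 * cv (inl j)) * h * ((cv (inl j))^-1 * cv u) =
      (h ^ (c k)^-1) ^ cv u)%g.
    by rewrite /cv /= jk !conjgE invgK !mulgA.
  have := walk_cat (walk_cat (Wc _ _ uc vc) Wvw) (Wc _ _ wc uc).
  by rewrite conjgE !mulgA !mulgK.
have [h Wul] := strong ic lc.
by have := walk_cat (Wuu (g * h^-1)%g) Wul; rewrite mulgKV.
Qed.

End WalksGenerate.

(** * Small generating sets of the core *)

Lemma core_generating_set i0 l0 r :
    i0 \in Ic -> l0 \in Lc -> #|Ic| <= r -> #|Lc| <= r ->
    sigma_min P Ib Lb + n <= r.+1 ->
  exists2 X : {set rees gT I L}, #|X| <= r &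
    forall i g l, i \in Ic -> l \in Lc -> Some (i, g, l) \in gen X.
Proof.
move=> i0c l0c ler lel les.
have [|a ac' asur'] := @cover_function 'I_r I setT Ic i0.
  by rewrite cardsT card_ord.
have [|b bc' bsur'] := @cover_function 'I_r L setT Lc l0.
  by rewrite cardsT card_ord.
have ac t : a t \in Ic by case: (ac' t) => [->|].
have bc t : b t \in Lc by case: (bc' t) => [->|].
have asur i : i \in Ic -> exists t, a t = i by case/asur'=> t _; exists t.
have bsur l : l \in Lc -> exists t, b t = l by case/bsur'=> t _; exists t.
(* Pair [t] leads to pair [t'] if the row of [t] and the column of [t'] meet at a non-zero entry.
   The permutation [p] re-pairs the rows with the columns. *)
have [||p conn] := @strongly_connecting_perm 'I_r [rel t t' | P (b t) (a t') != None].
- move=> t; have [i [x Pti]] := nonzero_rowP _ _ (bc t).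
  by have [t' at'] := asur i (entry_col Pti); exists t'; rewrite /= at' Pti.
- move=> t'; have [l [x Plt]] := nonzero_colP _ _ (ac t').
  by have [t bt] := bsur l (entry_row Plt); exists t; rewrite /= bt Plt.
pose s t := col_block (a t); pose d t := row_block (b (p t)).
have [|Z [_ cZ span _]] := @spanning_tree 'I_n 'I_r setT s d k0.
  move=> A k0A AT; apply/exists_inP; apply: contraT.
  rewrite negb_exists_in => /forall_inP nocross.
  have {}nocross t : (s t \in A) = (d t \in A).
    by apply/eqP; have := nocross t (in_setT t); rewrite negbK.
  have /subsetPn[k _ kA] : ~~ ([set: 'I_n] \subset A) by rewrite subTset.
  have [i ic ik] := block_col_ex k0; have [j jc jk] := block_col_ex k.
  have [t at_i] := asur i ic; have [t' at_j] := asur j jc.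
  suff: s t' \in A by rewrite /s at_j jk (negPf kA).
  (* Were no pair to cross the cut, a path of pairs starting in [A] would stay in [A], because
     entries do not change the block. *)
  apply: (connect_propagate (conn t t') (Q := fun t => s t \in A)).
    by rewrite /s at_i ik.
  move=> x y; rewrite nocross /s /d /=.
  by case Pxy: (P _ _) => [q|] //; rewrite (entry_block Pxy).
rewrite card_ord in cZ.
have [[c sc] _] := sigma_minP P Ib Lb.
have [[Y genY cY] _] :=
  relative_rankP (\bigcup_k (block_group P Ib Lb k :^ (c k)^-1))%g.
have [|f _ fsur] := @cover_function 'I_r gT (~: Z) Y 1%g.
  (* The set [Y] has [sigma_min] elements, and [r - (n - 1)] pairs lie off the tree. *)
  rewrite cY -/(sigma P Ib Lb c) sc -(leq_add2l #|Z|) cardsC card_ord.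
  by rewrite addnC -ltnS -addnS [in _ + _]cZ.
pose y t := if t \in Z then 1%g else f t.
(* On the tree the label is the quotient of potentials required by [c]. Off the tree it also carries
   an element of [Y], or the filler 1. *)
pose h t := ((c (s t))^-1 * y t * c (d t))%g.
pose X : {set rees gT I L} := [set Some (a t, h t, b (p t)) | t in 'I_r].
exists X; first by rewrite (leq_trans (leq_imset_card _ _)) // card_ord.
have Wt t : walk (rees_step X) (inl (a t)) (inr (b (p t))) (h t).
  by apply: walk_edge; apply/imsetP; exists t.
have strong i l : i \in Ic -> l \in Lc ->
    exists g, walk (rees_step X) (inl i) (inr l) g.
  move=> /asur[t <-] /bsur[t' <-]; rewrite -[t'](permKV p).
  apply: (connect_propagate (conn t (p^-1 t')%g)
    (Q := fun t' => exists g, walk (rees_step X) (inl (a t)) (inr (b (p t'))) g)).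
    by exists (h t).
  move=> u v [g Wg] /=; case Puv: (P _ _) => [q|] // _.
  exists (g * q * h v)%g; apply: walk_cat (Wt v).
  by apply: walk_cat Wg _; apply: walk_edge.
have Wc u v : vertex_core u -> vertex_core v ->
    walk (rees_step X) u v ((c (vertex_block u))^-1 * c (vertex_block v))%g.
  have [j jc jk] := block_col_ex k0.
  have uc : vertex_core (inl j) by [].
  suff base v' : vertex_core v' ->
      walk (rees_step X) (inl j) v' ((c k0)^-1 * c (vertex_block v'))%g.
    move=> u'c v'c; have := walk_cat (core_walkV strong uc u'c (base u u'c)) (base v v'c).
    by rewrite invMg invgK mulgA mulgK.
  (* The label predicted by [c] spreads from block to block along the tree, against the direction of
     a pair by inverting its walk, and inside a block by walks of label 1. *)
  pose Q k := forall v', vertex_core v' -> vertex_block v' = k ->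
    walk (rees_step X) (inl j) v' ((c k0)^-1 * c k)%g.
  suff QT k : Q k by move=> vc; apply: QT.
  apply: span k => [t tZ|v'' vc vk]; last first.
    by rewrite mulVg; apply: block_walk1 => //=; rewrite jk.
  have ht : h t = ((c (s t))^-1 * c (d t))%g by rewrite /h /y tZ mulg1.
  have sc' : vertex_core (inl (a t)) by apply: ac.
  have dc' : vertex_core (inr (b (p t))) by apply: bc.
  split=> Qt v'' vc vk.
    have := walk_cat (Qt _ sc' erefl) (Wt t); rewrite ht mulgA mulgK => Wd.
    rewrite -[X in walk _ _ _ X]mulg1; apply: walk_cat Wd _.
    exact: block_walk1.
  have := walk_cat (Qt _ dc' erefl) (core_walkV strong sc' dc' (Wt t)).
  rewrite ht invMg invgK mulgA mulgK => Ws.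
  rewrite -[X in walk _ _ _ X]mulg1; apply: walk_cat Ws _.
  exact: block_walk1.
apply: (core_generated strong Wc _ genY) => x /fsur[t tZ ft].
exists (inl (a t)), (inr (b (p t))); split; [exact: ac | exact: bc | ].
by have := Wt t; rewrite /h /y; rewrite inE in tZ; rewrite (negPf tZ) ft.
Qed.

End Blocks.

(** * Adding generators for zero columns and zero rows *)

Section Extension.
Variables (gT : finGroupType) (I L : finType) (P : L -> I -> option gT).
Local Notation Ic := (~: zero_cols P).
Local Notation Lc := (~: zero_rows P).
Local Notation gen := (generated0 (rees_mul P) (rees_zero gT I L)).

(** One generator per zero column, ending in the non-zero row [l0], can be continued by a core
    element whose label cancels the entry [p0]. Zero rows are treated dually through [i0]. *)
Lemma core_generating_extend (X : {set rees gT I L}) i0 l0 :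
    i0 \in Ic -> l0 \in Lc ->
    (forall i g l, i \in Ic -> l \in Lc -> Some (i, g, l) \in gen X) ->
  exists2 X' : {set rees gT I L},
    #|X'| <= #|X| + #|zero_cols P| + #|zero_rows P| & gen X' = [set: rees gT I L].
Proof.
move=> i0c l0c GX.
pose X1 : {set rees gT I L} := [set Some (i, 1%g, l0) | i in zero_cols P].
pose X2 : {set rees gT I L} := [set Some (i0, 1%g, l) | l in zero_rows P].
exists (X :|: X1 :|: X2).
  apply: leq_trans (leq_card_setU _ _).1 _; apply: leq_add; last exact: leq_imset_card.
  apply: leq_trans (leq_card_setU _ _).1 _; apply: leq_add; last exact: leq_imset_card.
  by [].
set X' := X :|: X1 :|: X2.
have sub x : x \in gen X -> x \in gen X'.
  rewrite !inE => /asboolP[->|[y [s [yX sX ->]]]]; apply/asboolP; [by left | right].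
  exists y, s; split=> // [|z /sX zX]; by rewrite !inE ?yX ?zX.
have [j0 [p0 P0]] := nonzero_rowP _ _ l0c; have [m0 [q0 Q0]] := nonzero_colP _ _ i0c.
have Gcol i g l : l \in Lc -> Some (i, g, l) \in gen X'.
  move=> lc; case: (boolP (i \in Ic)) => [ic|]; first exact/sub/GX.
  rewrite in_setC negbK => iz.
  have Gi : Some (i, 1%g, l0) \in gen X'.
    by apply: mem_generated0; rewrite !in_setU (imset_f _ iz) !orbT.
  have Gj := sub _ (GX j0 (p0^-1 * g)%g l (entry_col P0) lc).
  by have := gen_prod Gi P0 Gj; rewrite mul1g mulKVg.
apply/setP => x; rewrite in_setT; case: x => [[[i g] l]|]; last first.
  by rewrite inE; apply/asboolP; left.
case: (boolP (l \in Lc)) => [lc|]; first exact: Gcol.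
rewrite in_setC negbK => lz.
have Gl : Some (i0, 1%g, l) \in gen X'.
  by apply: mem_generated0; rewrite !in_setU (imset_f _ lz) !orbT.
have Gm := Gcol i (g * q0^-1)%g m0 (entry_row Q0).
by have := gen_prod Gm Q0 Gl; rewrite mulg1 mulgKV.
Qed.

End Extension.

Theorem theorem7 (gT : finGroupType) (I L : finType)
    (I_gt0 : 0 < #|I|) (L_gt0 : 0 < #|L|)
    (P : L -> I -> option gT)
    (n : nat) (Ib : 'I_n -> {set I}) (Lb : 'I_n -> {set L})
    (gnfP : graham_normal_form P Ib Lb) :
  ((forall l i, P l i = None) -> rees_rank P = #|gT| * #|I| * #|L|) /\
  (~ (forall l i, P l i = None) ->
     rees_rank P =
       maxn (maxn #|~: zero_cols P| #|~: zero_rows P|)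
            (sigma_min P Ib Lb + n - 1)
       + #|zero_cols P| + #|zero_rows P|).
Proof.
split=> [|Pnz]; first exact: rank_zero_matrix.
have [l0 [i0 [p0 P0]]] : exists l i p, P l i = Some p.
  apply: contra_notP Pnz => Pz l i; case Pli: (P l i) => [p|] //.
  by case: Pz; exists l, i, p.
have i0c := entry_col P0; have l0c := entry_row P0.
(* A non-zero entry provides a block, which serves as base point and default. *)
have /bigcupP[k0 _ _] : i0 \in \bigcup_k Ib k by rewrite (gnf_cover_cols gnfP).
have [[X gX cX] minX] := semigroup_rank0P (rees_mul P) (rees_zero gT I L).
apply/eqP; rewrite eqn_leq; apply/andP; split.
  set r := maxn _ _.
  have [|||X0 cX0 GX0] := core_generating_set gnfP k0 (r := r) i0c l0c.
  - by rewrite !leq_max leqnn.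
  - by rewrite !leq_max leqnn orbT.
  - by rewrite -add1n -leq_subLR leq_max leqnn orbT.
  have [X' cX' gX'] := core_generating_extend i0c l0c GX0.
  apply: leq_trans (minX _ gX') (leq_trans cX' _).
  by rewrite !leq_add2r.
have [le1 le2] := card_generating_ge gX i0c l0c.
rewrite /rees_rank -cX (leq_trans _ le1) // !leq_add2r geq_max le2 /=.
by rewrite leq_subLR add1n (sigma_min_le gnfP k0).
Qed.
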